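(* For all $a>0$ and all integers $n\geq1$, the $n$-th moment of the Marchenko–Pastur distribution with parameter $a$ is equal to $\sum_{\pi}a^{o(\pi)}$, where the sum is taken over all noncrossing pairings $\pi$ of $\{1,\dots,2n\}$ and $o(\pi)$ is the number of blocks of $\pi$ whose minimum is odd.
   Context: The Marchenko–Pastur distribution with parameter $a>0$ is the probability measure on $[0,+\infty)$ equal to $\max(1-a,0)\,\delta_0+\frac{(4a-(x-1-a)^2)^{1/2}}{2\pi x}\chi_a(x)\,dx$, where $\chi_a$ is the characteristic function of $[(1-a^{1/2})^2,(1+a^{1/2})^2]$. A noncrossing pairing is a noncrossing partition all of whose blocks have cardinality two. *)

(* Defs.v *)
From HB Require Import structures.
From mathcomp Require Import all_boot all_order all_algebra.
From mathcomp Require Import all_classical all_reals all_analysis.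
From mathcomp Require Import measurable_realfun.

Set Implicit Arguments.
Unset Strict Implicit.
Unset Printing Implicit Defensive.

Import Order.TTheory GRing.Theory Num.Theory.
Import numFieldNormedType.Exports.

(* The ordinal i : 'I_m stands for the element i + 1 of {1, ..., m}. *)
Section NoncrossingPairings.
Local Open Scope nat_scope.
Variable m : nat.
Implicit Type P : {set {set 'I_m}}.

Definition noncrossing P : bool :=
  [forall B in P, forall C in P,
   forall i in B, forall j in C, forall k in B, forall l in C,
     [&& i < j, j < k & k < l] ==> (B == C)].

Definition noncrossing_partition P : bool :=
  finset.partition P [set: 'I_m]%SET && noncrossing P.

Definition noncrossing_pairing P : bool :=
  noncrossing_partition P && [forall B in P, #|B| == 2].

(* [i.+1] rather than [i]: parity is that of the label in {1, ..., m}. *)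
Definition min_odd (B : {set 'I_m}) : bool :=
  [exists i in B, [forall j in B, i <= j] && odd i.+1].

Definition odd_blocks P : nat := #|[set B in P | min_odd B]%SET|.

End NoncrossingPairings.

Section MarchenkoPasturDensity.
Context {R : realType}.
Variable a : R.
Local Open Scope classical_set_scope.
Local Open Scope ring_scope.
Local Notation mu := (@lebesgue_measure R).

Definition mp_support : set R :=
  `[(1 - Num.sqrt a) ^+ 2, (1 + Num.sqrt a) ^+ 2].

(* When a = 1 the support contains 0, where the total division of the library
   gives the value 0; this does not affect integrals. *)
Definition mp_density (x : R) : R :=
  Num.sqrt (4 * a - (x - 1 - a) ^+ 2) / (2 * pi * x) * \1_mp_support x.

Definition mp_ac (U : set R) : \bar R :=
  (\int[mu]_(x in U) (mp_density x)%:E)%E.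

Lemma mp_density_ge0 x : 0 <= mp_density x.
Proof.
rewrite /mp_density indicE.
have [|_] := boolP (x \in mp_support); last by rewrite mulr0.
rewrite inE /mp_support/= in_itv/= => /andP[lx _].
have x0 : 0 <= x by apply: le_trans lx; exact: sqr_ge0.
by rewrite mulr1 divr_ge0 ?sqrtr_ge0// mulr_ge0// mulr_ge0// pi_ge0.
Qed.

Let measurable_inv : measurable_fun setT (@GRing.inv R).
Proof.
rewrite -(setvU [set 0]).
apply/measurable_funU; [exact: measurableC|by []|split].
  apply: open_continuous_measurable_fun.
    by rewrite openC; exact: closed_eq.
  by move=> x; rewrite inE /= => /eqP x0; exact: inv_continuous.
exact: measurable_fun_set1.
Qed.

Lemma measurable_mp_density : measurable_fun setT mp_density.
Proof.
apply: measurable_funM => /=; last first.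
  by apply: measurable_indic; exact: measurable_itv.
apply: measurable_funM => /=.
  apply: (measurableT_comp (f := @Num.sqrt R)).
    by apply: continuous_measurable_fun; exact: sqrt_continuous.
  apply: measurable_funB => //; apply: measurable_funX.
  by apply: measurable_funB => //; exact: measurable_funB.
by apply: (measurableT_comp measurable_inv); exact: measurable_funM.
Qed.

Let mp_ac0 : mp_ac set0 = 0%E.
Proof. by rewrite /mp_ac integral_set0. Qed.

Let mp_ac_ge0 U : (0 <= mp_ac U)%E.
Proof. by apply: integral_ge0 => x _; rewrite lee_fin mp_density_ge0. Qed.

Let mp_ac_sigma_additive : semi_sigma_additive mp_ac.
Proof.
move=> /= F mF tF mUF; rewrite /mp_ac; apply: cvg_toP.
  apply: ereal_nondecreasing_is_cvgn => m n mn.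
  apply: lee_sum_nneg_natr => // k _ _.
  by apply: integral_ge0 => /= x Fkx; rewrite lee_fin mp_density_ge0.
rewrite ge0_integral_bigcup//=.
- apply: measurable_funTS; apply: measurableT_comp => //.
  exact: measurable_mp_density.
- by move=> x _; rewrite lee_fin mp_density_ge0.
Qed.

HB.instance Definition _ := isMeasure.Build _ _ _ mp_ac
  mp_ac0 mp_ac_ge0 mp_ac_sigma_additive.

End MarchenkoPasturDensity.

Section MarchenkoPastur.
Context {R : realType}.
Variable a : R.
Local Open Scope ring_scope.

Lemma mp_atom_ge0 : 0 <= Num.max (1 - a) 0.
Proof. by rewrite le_max lexx orbT. Qed.

Definition mp_atom : {nonneg R} := NngNum mp_atom_ge0.

Definition marchenko_pastur : set R -> \bar R :=
  measure_add (mscale mp_atom (@dirac _ R 0 R)) (mp_ac a).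

HB.instance Definition _ := Measure.on marchenko_pastur.

End MarchenkoPastur.

Definition moment {R : realType} (mu : {measure set R -> \bar R}%R) (n : nat)
  : \bar R := (\int[mu]_x (x ^+ n)%:E)%E.

(* Main.v *)
Require Import Defs.
From HB Require Import structures.
From mathcomp Require Import all_boot all_order all_algebra.
From mathcomp Require Import all_classical all_reals all_analysis.
From mathcomp Require Import measurable_realfun ring lra zify.

(* Noncrossing side: removing the block {x, j} of the first point x of an
   interval leaves noncrossing pairings of (x, j) and (j, hi), and passing to
   (x, j) exchanges the two parities.  Writing m_k for the generating sum over
   pairings of 2(k + 1) points whose first point has an even label, so that its
   block weighs 1, this gives
     m_0 = 1,  m_{k+1} = (1 + a) m_k + a sum_{i<k} m_i m_{k-1-i},
   and the generating sum of the theorem is a m_{n-1}.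
   Analytic side: the atom at 0 does not contribute, and x^n cancels the pole
   1/x of the density, leaving moments of the semicircle law of centre 1 + a and
   variance a.  Integrating the derivative of x^k q(x)^(3/2), where
   q(x) = 4 a - (x - 1 - a)^2, gives a three-term recurrence for them.  It
   implies the quadratic recurrence above because it says that the generating
   series satisfies the differential equation of sqrt ((1 - c z)^2 - 4 a z^2)
   with c = 1 + a. *)

Import Order.TTheory GRing.Theory Num.Theory.
Local Open Scope ring_scope.

(** * Formal power series, truncated to polynomials *)

Section TruncatedSeries.
Variable R : realFieldType.
Implicit Types (p q D E W : {poly R}) (N k : nat).

Lemma coef_mul_trunc p q (N k : nat) : (k < N)%N ->
  (forall i, (i < N)%N -> p`_i = 0) -> (p * q)`_k = 0.
Proof.
move=> kN p0; rewrite coefM big1 // => i _.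
by rewrite p0 ?mul0r //; apply: leq_ltn_trans kN; rewrite -ltnS.
Qed.

Lemma linear_ode_trunc D E N : D`_0 != 0 -> E`_0 = 0 ->
  (forall k, (k < N)%N -> (E^`() * D - E * D^`())`_k = 0) ->
  forall k, (k <= N)%N -> E`_k = 0.
Proof.
move=> D0 E0 ode; elim/ltn_ind => -[//|k] IH kN.
have := ode k kN; rewrite coefB [(E * _)`_k]coefM big1 => [|i _]; last first.
  by rewrite IH ?mul0r //; have := ltn_ord i; lia.
rewrite subr0 coefM big_ord_recr /= big1 => [|i _]; last first.
  by rewrite coef_deriv IH ?mul0rn ?mul0r //; have := ltn_ord i; lia.
rewrite add0r subnn coef_deriv => /eqP.
by rewrite mulf_eq0 (negPf D0) orbF mulrn_eq0 /= => /eqP.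
Qed.

(** The difference E = W^2 - D satisfies E' D - E D' = (2 D W' - D' W) W, so [linear_ode_trunc]
    applies to it. *)
Lemma square_trunc D W N : D`_0 != 0 -> W`_0 ^+ 2 = D`_0 ->
  (forall k, (k < N)%N -> (2%:P * D * W^`() - D^`() * W)`_k = 0) ->
  forall k, (k <= N)%N -> (W ^+ 2)`_k = D`_k.
Proof.
move=> D0 W0 ode k kN; apply/eqP; rewrite -subr_eq0 -coefB; apply/eqP.
apply: (@linear_ode_trunc D (W ^+ 2 - D) N) => // [|j jN].
  by rewrite coefB -W0 expr2 coefM big_ord1 expr2 subrr.
have -> : (W ^+ 2 - D)^`() * D - (W ^+ 2 - D) * D^`()
  = (2%:P * D * W^`() - D^`() * W) * W.
  by rewrite derivB expr2 derivM; ring.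
exact: coef_mul_trunc jN ode.
Qed.

(* [W = 1 - c z - 2 a z^2 sum_k m_k z^k] is the square root of
   [D = (1 - c z)^2 - 4 a z^2]: the three-term recurrence of [m] is
   [2 D W' = D' W], and [W^2 = D] is the claimed quadratic recurrence. *)
Lemma three_term_quadratic (a c : R) (m : nat -> R) : a != 0 -> m 0 = 1 ->
  (forall k, k.+3%:R * m k.+1
     = (2 * k + 3)%:R * c * m k - k%:R * (c ^+ 2 - 4 * a) * m k.-1) ->
  forall k, m k.+1 = c * m k + a * \sum_(i < k) m i * m (k.-1 - i)%N.
Proof.
move=> a0 m0 rec k.
pose d := c ^+ 2 - 4 * a.
pose w i := if i is j.+2 then - (2 * a) * m j else if i is 1 then - c else 1.
(* The claim at k is read off coefficient k + 3 of W^2, which sees [w] only up to index k + 3. *)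
pose N := k.+4.
pose W := \poly_(i < N) w i.
pose D : {poly R} := 1 - (2 * c)%:P * 'X + d%:P * 'X^2.
have WE i : (i < N)%N -> W`_i = w i by move=> iN; rewrite coef_poly iN.
have D0 : D`_0 = 1 by rewrite !coefE /=; ring.
have D'E : D^`() = - (2 * c)%:P + (2 * d)%:P * 'X.
  by rewrite /D !poly.derivE !polyCM; ring.
have ode j : (j < k.+3)%N -> (2%:P * D * W^`() - D^`() * W)`_j = 0.
  move=> jk; have -> : 2%:P * D * W^`() - D^`() * W
      = 2%:P * (W^`() - (2 * c)%:P * (W^`() * 'X) + d%:P * (W^`() * 'X * 'X))
        + (2 * c)%:P * W - (2 * d)%:P * (W * 'X).
    by rewrite D'E /D !polyCM; ring.
  rewrite !(coefB, coefD, coefN, coefCM, coefMX, coef_deriv).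
  case: j jk => [|[|[|j]]] jk /=; rewrite !WE /w; try (rewrite /N; lia).
  - ring.
  - by rewrite m0 /d; ring.
  (* From degree 2 on, the coefficient of the differential equation is - 4 a times the three-term
     recurrence taken two indices lower. *)
  - have /= /eqP := rec 0%N; rewrite -subr_eq0 => /eqP /(congr1 ( *%R (- 4 * a))).
    by rewrite mulr0 => r; apply: etrans r; rewrite ?m0 /d; ring.
  - have /= /eqP := rec j.+1; rewrite -subr_eq0 => /eqP /(congr1 ( *%R (- 4 * a))).
    by rewrite mulr0 => r; apply: etrans r; rewrite ?m0 /d; ring.
have := @square_trunc D W k.+3 _ _ ode k.+3 (leqnn _).
rewrite D0 oner_eq0 WE // expr1n => /(_ isT erefl).
have -> : D`_k.+3 = 0.
  by rewrite !(coefB, coefD, coefN, coefCM, coef1, coefX, coefXn) /=; ring.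
(* The outermost terms give - 4 a m_{k+1}, the next ones 4 a c m_k, and the k middle ones 4 a^2
   times the convolution. The total is 0, since [D] has degree at most 2. *)
rewrite expr2 coefM big_ord_recl big_ord_recl big_ord_recr big_ord_recr /=.
have -> : \sum_(i < k) W`_(bump 0 (bump 0 i)) * W`_(k.+3 - bump 0 (bump 0 i))
    = (4 * a ^+ 2) * \sum_(i < k) m i * m (k.-1 - i)%N.
  rewrite big_distrr; apply: eq_bigr => i _ /=.
  have ik := ltn_ord i; rewrite !WE; try (rewrite /N /bump; lia).
  have -> : (k.+3 - bump 0 (bump 0 i))%N = (k.-1 - i).+2 by rewrite /bump; lia.
  by rewrite /w /=; ring.
rewrite !WE; try (rewrite /N /bump; lia).
have -> : (k.+3 - bump 0 (bump 0 k))%N = 1%N by rewrite /bump; lia.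
have -> : (k.+3 - bump 0 (bump 0 k.+1))%N = 0%N by rewrite /bump; lia.
rewrite !subSS subn0 /w /= => WW.
apply: (mulfI (mulf_neq0 (_ : 4 != 0 :> R) a0)); first by rewrite pnatr_eq0.
by lra.
Qed.
End TruncatedSeries.

(** * Noncrossing pairings of intervals *)

Section IntervalPairings.
Import mathcomp.boot.fintype mathcomp.boot.finset.
Variable N : nat.
Local Open Scope nat_scope.
Implicit Types (P Q : {set {set 'I_N}}) (B C : {set 'I_N}) (i j u v x y : 'I_N).
Implicit Types lo hi : nat.

Definition itv_set lo hi : {set 'I_N} := [set i : 'I_N | lo <= i < hi].

(** Pairings of all intervals share the ambient type ['I_N]: joining two of them is a plain union,
    and every point keeps its label, hence its parity. *)
Definition itv_pairing lo hi P : bool :=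
  [&& finset.partition P (itv_set lo hi), noncrossing P
    & [forall B in P, #|B| == 2]].

Lemma itv_pairingT P : itv_pairing 0 N P = noncrossing_pairing P.
Proof.
rewrite /itv_pairing /noncrossing_pairing /noncrossing_partition andbA.
by congr (finset.partition _ _ && _ && _); apply/setP=> i; rewrite !inE ltn_ord.
Qed.

Definition pairs_of lo hi P := forall B, B \in P ->
  exists u v, [/\ lo <= u, u < v, v < hi & B = [set u; v]].
Definition covers lo hi P := forall y, lo <= y < hi -> exists2 B, B \in P & y \in B.
Definition disjoint_blocks P := forall B C y,
  B \in P -> C \in P -> y \in B -> y \in C -> B = C.
Definition uncrossed P := forall B C i j k l, B \in P -> C \in P ->
  i \in B -> j \in C -> k \in B -> l \in C -> i < j -> j < k -> k < l -> B = C.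

Lemma itv_pairingP lo hi P : reflect
  [/\ pairs_of lo hi P, covers lo hi P, disjoint_blocks P & uncrossed P]
  (itv_pairing lo hi P).
Proof.
apply: (iffP and3P) => [[/and3P[/eqP covP triv n0] nc card2]|[pP cP dP uP]].
  split.
  - move=> B BP; have /cards2P[u [v [uv BE]]] : #|B| == 2.
      by move/forall_inP: card2; exact.
    have sub y : y \in B -> lo <= y < hi.
      move=> yB; have : y \in cover P by apply/bigcupP; exists B.
      by rewrite covP inE.
    have /andP[ulo uhi] : lo <= u < hi by apply: sub; rewrite BE !inE eqxx.
    have /andP[vlo vhi] : lo <= v < hi by apply: sub; rewrite BE !inE eqxx orbT.
    have [ltuv|ltvu|/val_inj euv] := ltngtP u v.
    + by exists u, v; split.
    + by exists v, u; split; rewrite // setUC.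
    + by move: uv; rewrite euv eqxx.
  - move=> y ylh; have : y \in cover P by rewrite covP inE.
    by case/bigcupP => B; exists B.
  - move=> B C y BP CP yB yC; have /trivIsetP/(_ B C BP CP) := triv.
    case: eqP => // _ /(_ isT) /pred0P /(_ y) /=.
    by rewrite /= yB yC.
  - move=> B C i j k l BP CP iB jC kB lC ij jk kl.
    move/forall_inP: nc => /(_ B BP) /forall_inP /(_ C CP).
    move=> /forall_inP /(_ i iB) /forall_inP /(_ j jC).
    move=> /forall_inP /(_ k kB) /forall_inP /(_ l lC).
    by rewrite ij jk kl /= => /eqP.
split.
- apply/and3P; split.
  + apply/eqP/setP => y; rewrite inE; apply/bigcupP/idP => [[B BP yB]|/cP[B]].
      have [u [v [lou uv vhi BE]]] := pP B BP.
      by move: yB; rewrite BE !inE => /orP[/eqP->|/eqP->]; lia.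
    by exists B.
  + apply/trivIsetP => B C BP CP; apply: contraR => /pred0Pn[y /= /andP[yB yC]].
    by apply/eqP; exact: dP yB yC.
  + by apply/negP => /pP[u [v [_ _ _ /setP/(_ u)]]]; rewrite !inE eqxx.
- apply/forall_inP => B BP; apply/forall_inP => C CP.
  apply/forall_inP => i iB; apply/forall_inP => j jC.
  apply/forall_inP => k kB; apply/forall_inP => l lC.
  by apply/implyP => /and3P[ij jk kl]; apply/eqP; exact: uP iB jC kB lC _ _ _.
- apply/forall_inP => B /pP[u [v [_ uv _ ->]]]; rewrite cards2.
  by rewrite -val_eqE /= neq_ltn uv.
Qed.

Definition glue (x j : 'I_N) P Q : {set {set 'I_N}} := [set x; j] |: (P :|: Q).

Lemma in_glue x j P Q B :
  (B \in glue x j P Q) = [|| B == [set x; j], B \in P | B \in Q].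
Proof. by rewrite !inE. Qed.

(** The block {x, j}, the blocks of [P] and those of [Q] occupy separate regions: the two ends,
    strictly between them, and beyond j. Positions alone exclude a crossing between different
    regions. *)
Lemma glue_itv_pairing x j hi P Q : x < j < hi ->
  itv_pairing x.+1 j P -> itv_pairing j.+1 hi Q ->
  itv_pairing x hi (glue x j P Q).
Proof.
move=> /andP[xj jhi] /itv_pairingP[pP cP dP uP] /itv_pairingP[pQ cQ dQ uQ].
have glueP B : B \in glue x j P Q ->
  [\/ B = [set x; j] /\ (forall y, y \in B -> y = x :> nat \/ y = j :> nat),
      B \in P /\ (forall y, y \in B -> x < y < j)
    | B \in Q /\ (forall y, y \in B -> j < y < hi)].
  rewrite in_glue => /or3P[/eqP->|BP|BQ]; [apply: Or31|apply: Or32|apply: Or33].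
  - by split=> // y; rewrite !inE => /orP[]/eqP->; [left|right].
  - split=> // y; have [u [v [? ? ? ->]]] := pP B BP.
    by rewrite !inE => /orP[]/eqP->; lia.
  - split=> // y; have [u [v [? ? ? ->]]] := pQ B BQ.
    by rewrite !inE => /orP[]/eqP->; lia.
apply/itv_pairingP; split.
- move=> B; rewrite in_glue => /or3P[/eqP->|/pP|/pQ].
  + by exists x, j; split.
  + by move=> [u [v [? ? ? ->]]]; exists u, v; split => //; lia.
  + by move=> [u [v [? ? ? ->]]]; exists u, v; split => //; lia.
- move=> y yxhi; have [->|yx] := eqVneq y x.
    by exists [set x; j]; rewrite ?in_glue ?eqxx // !inE eqxx.
  have [->|yj] := eqVneq y j.
    by exists [set x; j]; rewrite ?in_glue ?eqxx // !inE eqxx orbT.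
  have [/cP|/cQ] : x.+1 <= y < j \/ j.+1 <= y < hi.
  + by move: yx yj; rewrite -!val_eqE /=; lia.
  + by move=> [B BP yB]; exists B; rewrite ?in_glue ?BP ?orbT.
  + by move=> [B BP yB]; exists B; rewrite ?in_glue ?BP ?orbT.
- move=> B C y /glueP[[EB HB]|[EB HB]|[EB HB]] /glueP[[EC HC]|[EC HC]|[EC HC]] yB yC;
    have := HB y yB; have := HC y yC; try by move=> ? ?; exfalso; lia.
  + by rewrite EB EC.
  + by move=> _ _; exact: dP yB yC.
  + by move=> _ _; exact: dQ yB yC.
- move=> B C i k l m.
  move=> /glueP[[EB HB]|[EB HB]|[EB HB]] /glueP[[EC HC]|[EC HC]|[EC HC]]
    iB kC lB mC ik kl lm;
    have := HB i iB; have := HB l lB; have := HC k kC; have := HC m mC;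
    try by move=> ? ? ? ?; exfalso; lia.
  + by move=> _ _ _ _; exact: uP iB kC lB mC _ _ _.
  + by move=> _ _ _ _; exact: uQ iB kC lB mC _ _ _.
Qed.

Definition restrict lo hi P : {set {set 'I_N}} :=
  [set B in P | B \subset itv_set lo hi].

(** A block {u, v} other than {x, j} avoids both points. As x is leftmost, u < j < v would give the
    crossing x < u < j < v. *)
Lemma itv_pairing_block_itv x j hi R B : itv_pairing x hi R ->
  [set x; j] \in R -> B \in R ->
  [|| B == [set x; j], B \subset itv_set x.+1 j | B \subset itv_set j.+1 hi].
Proof.
move=> /itv_pairingP[pR cR dR uR] XR BR.
have [|BX] := eqVneq B [set x; j] => //=.
have [x' [j' [xx' xj' j'hi XE]]] := pR _ XR.
have notX y : y \in B -> y != x /\ y != j.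
  move=> yB; split; apply/negP => /eqP yE; case/eqP: BX.
    by apply: dR yB _; rewrite // yE !inE eqxx.
  by apply: dR yB _; rewrite // yE !inE eqxx orbT.
have [u [v [xu uv vhi BE]]] := pR _ BR.
have [ux uj] : u != x /\ u != j by apply: notX; rewrite BE !inE eqxx.
have [vx vj] : v != x /\ v != j by apply: notX; rewrite BE !inE eqxx orbT.
move: ux uj vx vj; rewrite -!val_eqE /= => ux uj vx vj.
have ncross : ~ (u < j < v).
  move=> /andP[uj' jv]; case/eqP: BX; apply/esym.
  by apply: (uR _ _ x u j v); rewrite ?BE ?inE ?eqxx ?orbT // -?BE //; lia.
have subE l h : (B \subset itv_set l h) = (l <= u < h) && (l <= v < h).
  by rewrite BE subUset !sub1set !inE.
by rewrite !subE; lia.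
Qed.

Lemma itv_pairing_restrict x j hi R : itv_pairing x hi R -> [set x; j] \in R ->
  [/\ itv_pairing x.+1 j (restrict x.+1 j R),
      itv_pairing j.+1 hi (restrict j.+1 hi R)
    & glue x j (restrict x.+1 j R) (restrict j.+1 hi R) = R].
Proof.
move=> hR XR; have blk B := itv_pairing_block_itv _ _ _ _ B hR XR.
have /itv_pairingP[pR cR dR uR] := hR.
(* Treats both restrictions at once: the subinterval avoids x and j, and contains every block that
   meets it. *)
have sub l h : (forall y, l <= y < h -> x <= y < hi /\ y != x /\ y != j) ->
    (forall y B, B \in R -> y \in B -> l <= y < h -> B \subset itv_set l h) ->
    itv_pairing l h (restrict l h R).
  move=> lh sublh; apply/itv_pairingP; split.
  - move=> B; rewrite inE => /andP[BR /subsetP Blh].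
    have [u [v [xu uv vhi BE]]] := pR _ BR.
    exists u, v; split => //.
    + by have := Blh u; rewrite BE !inE eqxx => /(_ isT) /andP[].
    + by have := Blh v; rewrite BE !inE eqxx orbT => /(_ isT) /andP[].
  - move=> y ylh; have [xyhi _] := lh y ylh; have [B BR yB] := cR y xyhi.
    by exists B; rewrite // inE BR (sublh y).
  - by move=> B C y; rewrite !inE => /andP[BR _] /andP[CR _]; exact: dR.
  - by move=> B C i k l' m; rewrite !inE => /andP[BR _] /andP[CR _]; exact: uR.
(* That x < j is not assumed; it comes from comparing {x, j} with its sorted form {x', j'}. *)
have [x' [j' [xx' xj' j'hi XE]]] := pR _ XR.
have memX y : (y \in [set x; j]) = (y == x :> nat) || (y == j :> nat) by rewrite !inE.
have xhi : x < hi by lia.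
have xj : x < j.
  have := memX x'; have := memX j'; rewrite XE !inE !eqxx orbT /=.
  have : x \in [set x'; j'] by rewrite -XE !inE eqxx.
  rewrite !inE -!val_eqE /=; have := memX x.
  by rewrite !inE eqxx /=; lia.
have jhi : j < hi.
  have : j \in [set x'; j'] by rewrite -XE !inE eqxx orbT.
  by rewrite !inE -!val_eqE /=; lia.
split.
- apply: sub => [y|y B BR yB ylh]; first by rewrite -!val_eqE /=; lia.
  case/or3P: (blk B BR) => [/eqP BX||/subsetP/(_ y yB)] //.
    by move: yB; rewrite BX !inE -!val_eqE /=; lia.
  by rewrite inE; lia.
- apply: sub => [y|y B BR yB ylh]; first by rewrite -!val_eqE /=; lia.
  case/or3P: (blk B BR) => [/eqP BX|/subsetP/(_ y yB)|] //.
    by move: yB; rewrite BX !inE -!val_eqE /=; lia.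
  by rewrite inE; lia.
- apply/setP => B; rewrite in_glue !inE; apply/or3P/idP => [|BR].
    by case=> [/eqP->|/andP[]|/andP[]].
  by case/or3P: (blk B BR) => H;
    [apply: Or31|apply: Or32|apply: Or33]; rewrite ?BR ?H.
Qed.

Lemma in_itv_pairing_block lo hi P B y :
  itv_pairing lo hi P -> B \in P -> y \in B -> lo <= y < hi.
Proof.
move=> /itv_pairingP[pP _ _ _] /pP[u [v [? ? ? ->]]].
by rewrite !inE => /orP[]/eqP->; lia.
Qed.

Lemma block_sub_itv lo hi P B :
  itv_pairing lo hi P -> B \in P -> B \subset itv_set lo hi.
Proof.
move=> hP BP; apply/subsetP => y yB; rewrite inE.
exact: in_itv_pairing_block hP BP yB.
Qed.

Lemma block_neq0 lo hi P B : itv_pairing lo hi P -> B \in P -> B != set0.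
Proof.
move=> /itv_pairingP[pP _ _ _] /pP[u [v [_ _ _ ->]]].
by apply/set0Pn; exists u; rewrite !inE eqxx.
Qed.

Lemma sub_itvF lo hi lo' hi' P B : itv_pairing lo hi P -> B \in P ->
  (hi <= lo') || (hi' <= lo) -> (B \subset itv_set lo' hi') = false.
Proof.
move=> hP BP dis; apply/negP => /subsetP sB.
have /set0Pn[y yB] := block_neq0 _ _ _ _ hP BP.
have := in_itv_pairing_block _ _ _ _ _ hP BP yB.
by have := sB y yB; rewrite inE; lia.
Qed.

(** Blocks are nonempty, so a block of one side is never contained in the interval of the other. *)
Lemma restrict_glue x j hi P Q : x < j < hi ->
  itv_pairing x.+1 j P -> itv_pairing j.+1 hi Q ->
  restrict x.+1 j (glue x j P Q) = P /\ restrict j.+1 hi (glue x j P Q) = Q.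
Proof.
move=> xjhi hP hQ; split; apply/setP => B; rewrite !inE.
- have [BP|BP] := boolP (B \in P); first by rewrite orbT (block_sub_itv _ _ _ _ hP).
  have [BQ|BQ] := boolP (B \in Q).
    by rewrite (sub_itvF _ _ _ _ _ _ hQ BQ) ?andbF //; lia.
  rewrite !orbF; case: eqP => // -> /=.
  by apply/negP; rewrite subUset !sub1set !inE; lia.
- have [BQ|BQ] := boolP (B \in Q); first by rewrite !orbT (block_sub_itv _ _ _ _ hQ).
  have [BP|BP] := boolP (B \in P).
    by rewrite (sub_itvF _ _ _ _ _ _ hP BP) ?andbF //; lia.
  rewrite !orbF; case: eqP => // -> /=.
  by apply/negP; rewrite subUset !sub1set !inE; lia.
Qed.

(** The negation comes from the shift by one: position [x] carries the label x + 1. *)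
Lemma min_odd_pair x j : x < j -> min_odd [set x; j] = ~~ odd x.
Proof.
move=> xj; apply/exists_inP/idP => [[i]|ox].
  rewrite !inE => /orP[]/eqP-> /andP[/forall_inP min]; first by [].
  by have := min x; rewrite !inE eqxx => /(_ isT); lia.
exists x; first by rewrite !inE eqxx.
rewrite /= ox andbT; apply/forall_inP => i.
by rewrite !inE => /orP[]/eqP-> //; exact: ltnW.
Qed.

Lemma odd_blocksE P : odd_blocks P = \sum_(B in P) min_odd B.
Proof.
rewrite /odd_blocks -sum1_card big_mkcond [RHS]big_mkcond /=.
by apply: eq_bigr => B _; rewrite inE; case: (B \in P); case: (min_odd B).
Qed.

Lemma odd_blocks_glue x j hi P Q : x < j < hi ->
  itv_pairing x.+1 j P -> itv_pairing j.+1 hi Q ->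
  odd_blocks (glue x j P Q) = ~~ odd x + odd_blocks P + odd_blocks Q.
Proof.
move=> xjhi hP hQ; rewrite !odd_blocksE big_setU1 /=; last first.
  rewrite inE; apply/negP => /orP[/(in_itv_pairing_block _ _ _ _ x hP)|
                                  /(in_itv_pairing_block _ _ _ _ x hQ)];
  by rewrite !inE eqxx; lia.
rewrite min_odd_pair ?(andP xjhi).1 // -addnA -bigU; last first.
  apply/pred0Pn => -[B /andP[/= BP BQ]].
  have := sub_itvF _ _ x.+1 j _ _ hQ BQ.
  by rewrite (block_sub_itv _ _ _ _ hP BP); lia.
by congr (_ + _); apply: eq_bigl => B; rewrite !inE.
Qed.

(** * First-block decomposition of the generating sums *)

Section GeneratingFunction.
Variables (R : comRingType) (a : R).
Local Open Scope ring_scope.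

Definition pairing_sum lo hi : R :=
  \sum_(P | itv_pairing lo hi P) a ^+ odd_blocks P.

Lemma pairing_sum_itv0 lo : pairing_sum lo lo = 1.
Proof.
rewrite /pairing_sum (big_pred1 set0) => [|P].
  by rewrite odd_blocksE big_set0 expr0.
apply/itv_pairingP/eqP => [[pP _ _ _]|->].
  apply/setP => B; rewrite inE; apply/negP => /pP[u [v [? ? ? _]]]; lia.
split=> [B|y|B C y|B C i j k l]; rewrite ?inE //; lia.
Qed.

(** [glue] and [restrict] are mutually inverse between pairs of pairings of the two subintervals and
    pairings containing {x, j}; the weight is multiplicative because [odd_blocks] is additive under
    [glue]. *)
Lemma pairing_sum_block x j hi : (x < j < hi)%N ->
  \sum_(P | itv_pairing x hi P && ([set x; j] \in P)) a ^+ odd_blocks P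
  = a ^+ (~~ odd x) * pairing_sum x.+1 j * pairing_sum j.+1 hi.
Proof.
move=> xjhi; rewrite -mulrA [pairing_sum _ _ * _]big_distrlr /= pair_big /=.
rewrite (reindex_onto (fun PQ => glue x j PQ.1 PQ.2)
  (fun P => (restrict x.+1 j P, restrict j.+1 hi P))) /=; last first.
  by move=> P /andP[hP XP]; have [] := itv_pairing_restrict _ _ _ _ hP XP.
rewrite big_distrr /=; apply: eq_big => [[P Q]|[P Q] /=].
  rewrite /= xpair_eqE; apply/idP/andP => [/andP[/andP[hR XR]]|[hP hQ]].
    move=> /andP[/eqP PE /eqP QE].
    by have := itv_pairing_restrict _ _ _ _ hR XR; rewrite PE QE => -[].
  have [-> ->] := restrict_glue _ _ _ _ _ xjhi hP hQ.
  by rewrite glue_itv_pairing // in_glue !eqxx.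
move=> /andP[/andP[hR XR]] /eqP[PE QE].
have := itv_pairing_restrict _ _ _ _ hR XR; rewrite PE QE => -[hP hQ _].
by rewrite (odd_blocks_glue _ _ _ _ _ xjhi) // -addnA !exprD.
Qed.

Lemma pairing_sum_rec x hi : (x < hi)%N ->
  pairing_sum x hi = a ^+ (~~ odd x) *
    \sum_(j : 'I_N | (x < j < hi)%N) pairing_sum x.+1 j * pairing_sum j.+1 hi.
Proof.
move=> xhi; rewrite big_distrr /=.
under [RHS]eq_bigr do rewrite mulrA -pairing_sum_block //.
(* After the exchange, each pairing is counted once, for the unique partner j of x. *)
rewrite (exchange_big_dep (itv_pairing x hi)) /=; last by move=> ? ? _ /andP[].
apply: eq_bigr => P hP.
have /itv_pairingP[pP cP dP uP] := hP.
have [B BP xB] : exists2 B, B \in P & x \in B by apply: cP; rewrite leqnn.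
have [j xj BE] : exists2 j : 'I_N, (x < j < hi)%N & B = [set x; j].
  have [u [v [xu uv vhi BE]]] := pP B BP.
  move: xB; rewrite BE !inE => /orP[/eqP->|/eqP xv]; first by exists v => //; lia.
  by move: xu uv; rewrite xv; lia.
rewrite (big_pred1 j) // => i; apply/andP/eqP => [[/andP[xi _] /andP[_ iP]]|->].
  have E : [set x; i] = B by apply: (dP _ _ x); rewrite // !inE eqxx.
  have := set22 x i; rewrite E BE !inE => /orP[/eqP ix|/eqP//].
  by move: xi; rewrite ix ltnn.
by rewrite hP -BE.
Qed.

End GeneratingFunction.
End IntervalPairings.

(** * Solving the decomposition by the quadratic recurrence *)

Section QuadraticRecurrence.
Variables (R : comRingType) (a : R) (m : nat -> R).
Hypothesis m0 : m 0 = 1.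
Hypothesis mS : forall k, m k.+1 =
  (1 + a) * m k + a * \sum_(i < k) m i * m (k.-1 - i)%N.

(** Expected generating sum of an interval of [len] points whose first position has parity [o]. An
    even position has an odd label, which costs the factor [a]. *)
Let val (o : bool) (len : nat) : R :=
  if odd len then 0 else if len is 0 then 1 else a ^+ (~~ o) * m len./2.-1.

Let valE o k : val o (2 * k) = if k is l.+1 then a ^+ (~~ o) * m l else 1.
Proof.
rewrite /val mul2n odd_double; case: k => // k.
by rewrite doubleS -/double -doubleS doubleK.
Qed.

Lemma sum_ord_even (f : nat -> R) k : (forall i, odd i -> f i = 0) ->
  \sum_(i < (2 * k).+1) f i = \sum_(i < k.+1) f (2 * i)%N.
Proof.
move=> f0; elim: k => [|k IH]; first by rewrite !big_ord1.
rewrite [RHS]big_ord_recr -IH mulnS 2!big_ord_recr /=.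
by rewrite [f (2 * k).+1]f0 ?addr0 //= mul2n odd_double.
Qed.

(** The two factors start at opposite parities, so when both intervals are nonempty exactly one
    contributes [a]. The two extreme terms, where one interval is empty, add up to (1 + a) m_{k-1};
    the result is independent of [o]. *)
Let val_convolution o k :
  \sum_(i < k.+1) val (~~ o) (2 * i) * val o (2 * (k - i)) = m k.
Proof.
case: k => [|k]; first by rewrite big_ord1 mul1r m0.
rewrite big_ord_recl big_ord_recr mS /=.
have -> : \sum_(i < k) val (~~ o) (2 * bump 0 i) * val o (2 * (k.+1 - bump 0 i))
    = a * \sum_(i < k) m i * m (k.-1 - i)%N.
  rewrite big_distrr; apply: eq_bigr => i _ /=.
  have -> : (k.+1 - bump 0 i = (k.-1 - i).+1)%N.
    by rewrite /bump; have := ltn_ord i; lia.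
  by rewrite !valE; case: o => /=; ring.
by rewrite subnn subn0 !valE; case: o => /=; ring.
Qed.

Lemma pairing_sum_quadratic N lo len : (lo + len <= N)%N ->
  pairing_sum N R a lo (lo + len) =
  if odd len then 0 else if len is 0 then 1 else a ^+ (~~ odd lo) * m len./2.-1.
Proof.
rewrite -/(val (odd lo) len).
elim/ltn_ind: len lo => -[|len] IH lo loN; first by rewrite addn0 pairing_sum_itv0.
have ltloN : (lo < N)%N by lia.
rewrite (pairing_sum_rec _ _ _ (Ordinal ltloN)) /=; last by lia.
pose f (j : nat) := pairing_sum N R a lo.+1 j * pairing_sum N R a j.+1 (lo + len.+1).
(* With j = lo + 1 + i, the inner interval has i points from lo + 1 on, and the outer one has len -
   1 - i points from lo + i + 2 on. *)
have -> : \sum_(j : 'I_N | (lo < j < lo + len.+1)%N) f j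
    = \sum_(i < len) val (~~ odd lo) i * val (odd lo (+) odd i) (len.-1 - i).
  have hiN : (lo + len.+1 <= N)%N by [].
  rewrite (eq_bigl (fun j : 'I_N => (j < lo + len.+1) && (lo.+1 <= j))%N);
    last by move=> j; rewrite andbC.
  rewrite -(big_geq_mkord lo.+1 N (fun j => j < lo + len.+1)%N f).
  rewrite -(big_nat_widen _ _ _ predT f hiN) -[lo.+1]add0n big_addn.
  rewrite (_ : (lo + len.+1 - lo.+1)%N = len) ?big_mkord; last by lia.
  apply: eq_bigr => i _; have ilen := ltn_ord i; rewrite /f.
  have -> : (i + lo.+1 = lo.+1 + i)%N by lia.
  rewrite IH; [|lia|lia].
  have -> : (lo + len.+1 = (lo.+1 + i).+1 + (len.-1 - i))%N by lia.
  rewrite IH; [|lia|lia].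
  by rewrite /= oddD /= negbK.
have [elen|olen] := boolP (odd len); last first.
  (* With an odd number of points in all, one of the two subintervals has odd length, so every term
     vanishes. *)
  rewrite big1 ?mulr0 /val /= ?olen // => i _.
  have ilen := ltn_ord i; rewrite oddB; last by lia.
  have -> : odd len.-1.
    move: olen; rewrite -[X in odd X](prednK (_ : 0 < len)%N) /= ?negbK //.
    lia.
  by case: (odd i); rewrite ?mul0r ?mulr0.
have [k ->] : exists k, len = (2 * k).+1.
  by exists len./2; rewrite -[LHS]odd_double_half elen mul2n.
pose g i := val (~~ odd lo) i * val (odd lo (+) odd i) (2 * k - i).
rewrite (sum_ord_even g) => [|i oi]; last by rewrite /g /val oi mul0r.
under eq_bigr => i _ do rewrite /g mul2n odd_double addbF -mul2n -mulnBr.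
rewrite val_convolution (_ : (2 * k).+2 = 2 * k.+1)%N ?valE //; lia.
Qed.
End QuadraticRecurrence.

(** * Moments of the semicircle law *)

Section SemicircleMoments.
Import numFieldNormedType.Exports.
Variables (R : realType) (a : R).
Hypothesis a_gt0 : 0 < a.
Local Notation mu := (@lebesgue_measure R).
Local Notation lo := ((1 - Num.sqrt a) ^+ 2).
Local Notation hi := ((1 + Num.sqrt a) ^+ 2).

Definition mp_quad (x : R) : R := 4 * a - (x - 1 - a) ^+ 2.

Definition semicircle_moment (k : nat) : R :=
  (\int[mu]_(x in `[lo, hi]) (x ^+ k * Num.sqrt (mp_quad x)))%R.

Lemma mp_quad_factor x : mp_quad x = (x - lo) * (hi - x).
Proof.
have aE := sqr_sqrtr (ltW a_gt0).
by rewrite /mp_quad -{1 2}aE; ring.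
Qed.

Lemma mp_quad_gt0 x : x \in `]lo, hi[ -> 0 < mp_quad x.
Proof.
rewrite in_itv /= => /andP[lx xh].
by rewrite mp_quad_factor mulr_gt0 // subr_gt0.
Qed.

Lemma mp_support_lt : lo < hi.
Proof.
have s0 : 0 < Num.sqrt a by rewrite sqrtr_gt0.
by rewrite -subr_gt0 (_ : _ - _ = 4 * Num.sqrt a); [lra|ring].
Qed.

Lemma mp_quad_continuous : continuous mp_quad.
Proof.
move=> x; apply: cvgB; first exact: cvg_cst.
by apply: (@cvg_comp _ _ _ (fun y : R => y - 1 - a) (fun y => y ^+ 2));
  [apply: cvgB; [apply: cvgB; [exact: cvg_id|exact: cvg_cst]|exact: cvg_cst]
  |exact: exprn_continuous].
Qed.

Lemma sqrt_mp_quad_continuous : continuous (fun x => Num.sqrt (mp_quad x)).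
Proof.
move=> x; apply: (@continuous_comp _ _ _ mp_quad Num.sqrt).
  exact: mp_quad_continuous.
exact: sqrt_continuous.
Qed.

Lemma continuous_integrable_support (g : R -> R) : continuous g ->
  mu.-integrable `[lo, hi] (EFin \o g).
Proof.
move=> gc; apply: continuous_compact_integrable; first exact: segment_compact.
exact: continuous_subspaceT.
Qed.

Lemma is_derive_sqrt_mp_quad x : x \in `]lo, hi[ ->
  is_derive x 1 (fun x => Num.sqrt (mp_quad x))
    (- (x - 1 - a) / Num.sqrt (mp_quad x)).
Proof.
move=> /mp_quad_gt0 qx; have s0 : Num.sqrt (mp_quad x) != 0 by rewrite sqrtr_eq0 -ltNge.
have dq : is_derive x 1 mp_quad (- 2 * (x - 1 - a)).
  rewrite /mp_quad; apply: is_derive_eq.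
  by rewrite /GRing.scale /=; ring.
have ds := is_derive1_sqrt qx.
apply: (is_derive_eq (is_derive1_comp ds dq)).
by field.
Qed.

(** Derivatives are required only in the open interval, since the square root of [mp_quad] is not
    differentiable at the endpoints. *)
Lemma semicircle_FTC (f F : R -> R) :
  continuous F -> continuous f ->
  (forall x, x \in `]lo, hi[ -> is_derive x 1 F (f x)) ->
  (\int[mu]_(x in `[lo, hi]) f x)%R = F hi - F lo.
Proof.
move=> Fc fc dF; rewrite /Rintegral (@continuous_FTC2 _ f F) //.
- exact: mp_support_lt.
- exact: continuous_subspaceT.
- split.
  + by move=> x /dF[].
  + by apply: cvg_at_right_filter; exact: Fc.
  + by apply: cvg_at_left_filter; exact: Fc.
- by move=> x /dF dFx; rewrite derive1E; exact: derive_val.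
Qed.


(** With u = r sin t and y = r cos t, the quotient u / (r + y) is tan (t / 2). The left side is its
    derivative in u, as the product and inverse rules produce it from y' = - u / y. *)
Lemma half_angle_deriv_eq (u y r : R) : y != 0 -> r + y != 0 ->
  y ^+ 2 = r ^+ 2 - u ^+ 2 ->
  u * (- (r + y) ^- 2 * (- u / y)) + (r + y)^-1 * 1 = r / (y * (r + y)).
Proof.
move=> y0 ry0 yy; have uu : u ^+ 2 = r ^+ 2 - y ^+ 2 by rewrite yy; ring.
transitivity (u ^+ 2 / (y * (r + y) ^+ 2) + (r + y)^-1); first by field; apply/andP.
by rewrite uu; field; apply/andP.
Qed.

(** Says that u y / 2 + r^2 atan (u / (r + y)) is a primitive of y, the height of the half disc of
    radius r. *)
Lemma half_disc_deriv_eq (u y r : R) : r != 0 -> y != 0 -> r + y != 0 ->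
  y ^+ 2 = r ^+ 2 - u ^+ 2 ->
  u * y * (- 2 ^- 2 * 0) + 2^-1 * (u * (- u / y) + y * 1)
  + r ^+ 2 * ((1 + (u / (r + y)) ^+ 2)^-1 * (r / (y * (r + y)))) = y.
Proof.
move=> r0 y0 ry0 yy; have uu : u ^+ 2 = r ^+ 2 - y ^+ 2 by rewrite yy; ring.
have -> : 1 + (u / (r + y)) ^+ 2 = 2 * r / (r + y) by rewrite expr_div_n uu; field.
transitivity (2^-1 * (y - u ^+ 2 / y) + r ^+ 2 / (2 * y)).
  by field; rewrite r0 y0 ry0.
by rewrite uu; field.
Qed.

(** This is the area of a half disc of radius 2 sqrt a. *)
Lemma semicircle_moment0 : semicircle_moment 0 = 2 * pi * a.
Proof.
set s := Num.sqrt a; set c := 1 + a; set r := 2 * s.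
have s0 : 0 < s by rewrite sqrtr_gt0.
have aE : a = s ^+ 2 by rewrite sqr_sqrtr // ltW.
pose y x := Num.sqrt (mp_quad x).
have ry x : 0 < r + y x by apply: ltr_wpDr; rewrite ?sqrtr_ge0 // mulr_gt0.
pose t x := (x - c) * (r + y x)^-1.
(* [2 * atan (t x)] is [asin ((x - c) / r)], in a form that is visibly
   continuous at the endpoints. *)
pose F x := (x - c) * y x / 2 + r ^+ 2 * atan (t x).
have yc : continuous y by exact: sqrt_mp_quad_continuous.
have xc : continuous (fun x : R => x - c).
  by move=> x; apply: cvgB; [exact: cvg_id|exact: cvg_cst].
have tc : continuous t.
  move=> x; apply: cvgM; first exact: xc.
  by apply: cvgV; [rewrite gt_eqF|apply: cvgD; [exact: cvg_cst|exact: yc]].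
have Fc : continuous F.
  move=> x; apply: cvgD.
    by apply: cvgM; [apply: cvgM; [exact: xc|exact: yc]|exact: cvg_cst].
  apply: cvgM; first exact: cvg_cst.
  by apply: (@continuous_comp _ _ _ t atan); [exact: tc|exact: continuous_atan].
have dF x : x \in `]lo, hi[ -> is_derive x 1 F (y x).
  move=> xlohi; have qx := mp_quad_gt0 _ xlohi.
  have y0 : y x != 0 by rewrite sqrtr_eq0 -ltNge.
  have yy : y x ^+ 2 = r ^+ 2 - (x - c) ^+ 2.
    by rewrite sqr_sqrtr ?ltW // /mp_quad /r /c aE; ring.
  have dy : is_derive x 1 y (- (x - c) / y x).
    by have := is_derive_sqrt_mp_quad _ xlohi; rewrite -addrA -opprD.
  have dx : is_derive x 1 (fun x : R => x - c) 1.
    by apply: is_derive_eq; rewrite subr0.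
  have dt : is_derive x 1 t (r / (y x * (r + y x))).
    have dn : is_derive x 1 (fun x => r + y x) (- (x - c) / y x).
      apply: (is_derive_eq (is_deriveD (is_derive_cst r x 1) dy)).
      by rewrite add0r.
    have dv := @is_deriveV R (fun x => r + y x) x _ 1 (lt0r_neq0 (ry x)) dn.
    apply: (is_derive_eq (is_deriveM dx dv)).
    rewrite /GRing.scale /=.
    by apply: half_angle_deriv_eq => //; rewrite gt_eqF.
  have da := is_derive1_comp (is_derive1_atan (t x)) dt.
  apply: is_derive_eq.
  rewrite /GRing.scale /=.
  by apply: half_disc_deriv_eq => //; rewrite gt_eqF // mulr_gt0.
transitivity (F hi - F lo).
  apply: etrans (semicircle_FTC _ _ Fc yc dF); apply: eq_Rintegral => x _.
  by rewrite expr0 mul1r.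
have y_lo : y lo = 0 by rewrite /y mp_quad_factor subrr mul0r sqrtr0.
have y_hi : y hi = 0 by rewrite /y mp_quad_factor subrr mulr0 sqrtr0.
have r0 : r != 0 by rewrite mulf_neq0 // gt_eqF.
have t_hi : t hi = 1.
  by rewrite /t y_hi addr0 /c -/s aE (_ : _ - _ = r) ?mulfV // /r; ring.
have t_lo : t lo = - 1.
  by rewrite /t y_lo addr0 /c -/s aE (_ : _ - _ = - r) ?mulNr ?mulfV // /r; ring.
rewrite /F y_lo y_hi t_lo t_hi atanN atan1 /r -/s aE.
by field.
Qed.

Lemma semicircle_moment_rec k :
  k.+3%:R * semicircle_moment k.+1
  = (2 * k + 3)%:R * (1 + a) * semicircle_moment k
    - k%:R * ((1 + a) ^+ 2 - 4 * a) * semicircle_moment k.-1.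
Proof.
set c := 1 + a; pose y x := Num.sqrt (mp_quad x).
pose F x := x ^+ k * (mp_quad x * y x).
pose p j (x : R) := x ^+ j * y x.
have yc : continuous y by exact: sqrt_mp_quad_continuous.
have pc j : continuous (p j).
  by move=> x; apply: cvgM; [exact: exprn_continuous|exact: yc].
have Fc : continuous F.
  move=> x; apply: cvgM; first exact: exprn_continuous.
  by apply: cvgM; [exact: mp_quad_continuous|exact: yc].
pose f x := (2 * k + 3)%:R * c * p k x - k.+3%:R * p k.+1 x
            - k%:R * (c ^+ 2 - 4 * a) * p k.-1 x.
have fc : continuous f.
  move=> x; apply: cvgB; [apply: cvgB|]; apply: cvgM; try exact: cvg_cst; exact: pc.
have dF x : x \in `]lo, hi[ -> is_derive x 1 F (f x).
  move=> xlohi; have qx := mp_quad_gt0 _ xlohi.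
  have y0 : y x != 0 by rewrite sqrtr_eq0 -ltNge.
  have yy : y x ^+ 2 = mp_quad x by rewrite sqr_sqrtr ?ltW.
  have dy := is_derive_sqrt_mp_quad _ xlohi.
  have dq : is_derive x 1 mp_quad (- 2 * (x - c)).
    rewrite /mp_quad; apply: is_derive_eq.
    by rewrite /GRing.scale /= /c; ring.
  have dX : is_derive x 1 (fun z : R => z ^+ k) (k%:R * x ^+ k.-1).
    have := is_deriveX k (is_derive_id x (1 : R)).
    by rewrite exprfctE /GRing.scale /= mulr1.
  apply: (is_derive_eq (is_deriveM dX (is_deriveM dq dy))).
  rewrite mulrfctE /GRing.scale /= -/(y x).
  (* The derivative of q^(3/2) is - 3 (x - c) y; expanding q in powers of x then yields the three
     terms of [f]. *)
  transitivity (y x * (k%:R * x ^+ k.-1 * mp_quad x - 3 * x ^+ k * (x - c))).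
    by rewrite -yy /c; field.
  (* At k = 0 the truncated index [k.-1] is harmless, its coefficient being 0. *)
  rewrite /f /p /mp_quad /c; case: (k) => [|j] /=; first by ring.
  by rewrite !exprS; ring.
have := semicircle_FTC f F Fc fc dF.
have -> : F hi = 0 by rewrite /F mp_quad_factor subrr mulr0 mul0r mulr0.
have -> : F lo = 0 by rewrite /F mp_quad_factor subrr !mul0r mulr0.
have Zc b j : continuous (fun x => b * p j x).
  by move=> x; apply: cvgM; [exact: cvg_cst|exact: pc].
rewrite /f RintegralB //; try apply: continuous_integrable_support; try exact: Zc;
  last by move=> x; apply: cvgB; exact: Zc.
rewrite RintegralB //; try apply: continuous_integrable_support; try exact: Zc.
rewrite !RintegralZl //; try exact: continuous_integrable_support.
rewrite -![(\int[_]_(_ in _) p _ _)%R]/(semicircle_moment _).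
rewrite subr0 => E; apply/esym/eqP; rewrite -subr_eq0 -[X in _ == X]E; apply/eqP; ring.
Qed.

End SemicircleMoments.

(** * Integration against a measure given by a density *)

Section Density.
Context d (T : measurableType d) (R : realType).
Variables (mu nu : {measure set T -> \bar R}) (g : T -> R).
Hypothesis g_ge0 : forall x, 0 <= g x.
Hypothesis mg : measurable_fun setT g.
Hypothesis nuE : forall U, measurable U -> nu U = (\int[mu]_(x in U) (g x)%:E)%E.
Local Open Scope classical_set_scope.
Local Open Scope ereal_scope.
Import HBNNSimple.

Lemma integral_density_indic U : measurable U ->
  \int[nu]_x (\1_U x)%:E = \int[mu]_x ((\1_U x)%:E * (g x)%:E).
Proof.
move=> mU; rewrite integral_indic // setIT nuE // integral_mkcond /=.
apply: eq_integral => x _; rewrite patchE indicE.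
by case: ifPn => xU; rewrite ?mul1e ?mul0e.
Qed.

Lemma integral_density_nnsfun (f : {nnsfun T >-> R}) :
  \int[nu]_x (f x)%:E = \int[mu]_x ((f x)%:E * (g x)%:E).
Proof.
under [LHS]eq_integral do rewrite fimfunE -fsumEFin//.
rewrite [LHS]ge0_integral_fsum//; last 2 first.
  - by move=> r; exact/measurable_EFinP/measurableT_comp.
  - by move=> n x _; rewrite EFinM nnfun_muleindic_ge0.
under [RHS]eq_integral.
  move=> x xD; rewrite fimfunE -fsumEFin// ge0_mule_fsuml; last first.
    by move=> r; rewrite EFinM nnfun_muleindic_ge0.
  over.
rewrite [RHS]ge0_integral_fsum//; last 2 first.
  - move=> r; apply: emeasurable_funM; last exact/measurable_EFinP.
    by apply/measurable_EFinP; exact: measurableT_comp.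
  - move=> n x _; rewrite mule_ge0// ?lee_fin//.
    by rewrite -lee_fin EFinM nnfun_muleindic_ge0.
apply: eq_fsbigr => r _.
rewrite integralZl_indic_nnsfun //= integral_density_indic //.
under [RHS]eq_integral do rewrite EFinM -muleA.
have mr : measurable (f @^-1` [set r]) by [].
(* A negative r is not a value of [f]: its preimage is empty and both sides vanish. *)
have [r0|r0] := leP 0%R r.
  rewrite ge0_integralZl ?lee_fin //.
    apply: emeasurable_funM; last exact/measurable_EFinP.
    exact/measurable_EFinP/measurable_indic.
  by move=> x _; rewrite mule_ge0 ?lee_fin.
have -> : f @^-1` [set r] = set0 by exact: preimage_nnfun0.
by rewrite !integral0_eq ?mule0 // => x _; rewrite indic0 !mul0e ?mule0.
Qed.

Lemma ge0_integral_density (f : T -> \bar R) :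
  measurable_fun setT f -> (forall x, 0 <= f x) ->
  \int[nu]_x f x = \int[mu]_x (f x * (g x)%:E).
Proof.
move=> mf f0; pose f_ := nnsfun_approx measurableT mf.
transitivity (lim (\int[nu]_x (f_ n x)%:E @[n --> \oo])).
  rewrite -monotone_convergence//=.
  - apply: eq_integral => x _; apply/esym/cvg_lim => //=.
    exact: cvg_nnsfun_approx.
  - by move=> n; exact/measurable_EFinP.
  - by move=> n x _; rewrite lee_fin.
  - by move=> x _ m n mn; rewrite lee_fin; exact/lefP/nd_nnsfun_approx.
under eq_fun do rewrite integral_density_nnsfun.
rewrite -monotone_convergence//=.
- apply: eq_integral => x _; apply/cvg_lim => //=.
  by apply: cvgeZr => //; exact: cvg_nnsfun_approx.
- by move=> n; apply: emeasurable_funM; exact/measurable_EFinP.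
- by move=> n x _; rewrite mule_ge0 ?lee_fin.
- move=> x _ m n mn; rewrite lee_wpmul2r ?lee_fin //.
  exact/lefP/nd_nnsfun_approx.
Qed.

End Density.

(* The library's Lebesgue measure lives on [measurableTypeR R], whose
   sigma-algebra has the same sets as, but a different display from, that of
   [R]; transporting along the identity bridges the two. *)
Definition borel_id {R : realType} : measurableTypeR R -> R := idfun.

(** * Reduction of the moments to the semicircle law *)

Section MarchenkoPasturMoments.
Import numFieldNormedType.Exports.
Local Open Scope classical_set_scope.
Variables (R : realType) (a : R).
Hypothesis a_gt0 : 0 < a.
Local Notation leb := (@lebesgue_measure R).

Lemma ge0_integral_mp_ac (h : R -> \bar R) :
  measurable_fun setT h -> (forall x, 0 <= h x)%E ->
  (\int[mp_ac a]_x h x = \int[leb]_x (h x * (mp_density a x)%:E))%E.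
Proof.
move=> mh h0; have mid : measurable_fun setT (@borel_id R) by exact: measurable_id.
have transport U (f : R -> \bar R) : measurable U -> measurable_fun U f ->
    (forall x, 0 <= f x)%E ->
    (\int[pushforward leb (@borel_id R)]_(x in U) f x = \int[leb]_(x in U) f x)%E.
  by move=> mU mf f0; exact: (ge0_integral_pushforward mid leb mU mf).
have mg := @measurable_mp_density R a.
have mgE : measurable_fun setT (EFin \o mp_density a) by exact/measurable_EFinP.
(* [ge0_integral_density] needs both measures on one measurable type, so Lebesgue measure is first
   pushed to [R]. *)
pose leb' : {measure set R -> \bar R} := pushforward leb (@borel_id R).
rewrite -(transport setT) //; first last.
- by move=> x; rewrite mule_ge0 ?lee_fin ?mp_density_ge0.
- exact: emeasurable_funM.
apply: (ge0_integral_density _ _ _ (leb' mid) (mp_ac a) (mp_density a)) => //.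
  exact: mp_density_ge0.
move=> U mU; rewrite [RHS]transport // => [|x]; last by rewrite lee_fin mp_density_ge0.
exact: measurable_funTS.
Qed.

Lemma ge0_integral_marchenko_pastur (h : R -> \bar R) :
  measurable_fun setT h -> (forall x, 0 <= h x)%E ->
  (\int[marchenko_pastur a]_x h x =
   (mp_atom a)%:num%:E * h (0%R) + \int[leb]_x (h x * (mp_density a x)%:E))%E.
Proof.
move=> mh h0; rewrite /marchenko_pastur ge0_integral_measure_add //.
rewrite ge0_integral_mscale // integral_dirac // diracT mul1e.
by rewrite -ge0_integral_mp_ac.
Qed.

Lemma moment_marchenko_pastur n :
  moment (marchenko_pastur a) n.+1 = ((2 * pi)^-1 * semicircle_moment R a n)%:E.
Proof.
have mX : measurable_fun setT (fun x : R => (x ^+ n.+1)%:E).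
  by apply/measurable_EFinP; exact: exprn_measurable.
have supp_ge0 x : x \in mp_support a -> 0 <= x.
  rewrite inE /mp_support /= in_itv /= => /andP[lx _].
  by apply: le_trans lx; exact: sqr_ge0.
(* The formula is for nonnegative integrands, while x^(n+1) may be negative off the support; its
   negative part integrates to 0 because the density vanishes there. *)
rewrite /moment integralE !ge0_integral_marchenko_pastur //; first last.
- exact: measurable_funepos.
- exact: measurable_funeneg.
have -> : ((fun x => (x ^+ n.+1)%:E) ^\+ = fun x : R => maxe (x ^+ n.+1)%:E 0%E)%E.
  by apply/funext => x; rewrite funeposE.
have -> : ((fun x => (x ^+ n.+1)%:E) ^\- = fun x : R => maxe (- (x ^+ n.+1)%:E) 0%E)%E.
  by apply/funext => x; rewrite funenegE.
rewrite /= expr0n /= oppr0 maxxx mule0 !add0e.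
rewrite [X in (_ - X)%E]integral0_eq ?sube0; last first.
  move=> x _; rewrite /mp_density indicE.
  have [/supp_ge0 x0|_] := boolP (x \in mp_support a); last by rewrite mulr0 mule0.
  rewrite (_ : maxe _ _ = 0%E) ?mul0e //; apply/max_idPr.
  by rewrite lee_fin oppr_le0 exprn_ge0.
pose f x := (2 * pi)^-1 * (x ^+ n * Num.sqrt (mp_quad R a x)).
have fc : continuous f.
  move=> x; apply: cvgM; first exact: cvg_cst.
  by apply: cvgM; [exact: exprn_continuous|exact: sqrt_mp_quad_continuous].
have fint := continuous_integrable_support R a _ fc.
rewrite /semicircle_moment -RintegralZl //; last first.
  apply: continuous_integrable_support => x.
  by apply: cvgM; [exact: exprn_continuous|exact: sqrt_mp_quad_continuous].
rewrite /Rintegral fineK; last exact: integrable_fin_num fint.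
rewrite [RHS]integral_mkcond; apply: eq_integral => x _.
rewrite patchE /mp_density indicE -/(mp_support a).
have [xs|_] := boolP (x \in mp_support a); last by rewrite mulr0 mule0.
have x0 := supp_ge0 x xs.
rewrite (_ : maxe _ _ = (x ^+ n.+1)%:E); last first.
  by apply/max_idPl; rewrite lee_fin exprn_ge0.
rewrite -EFinM mulr1 exprSr; congr EFin.
have pi0 : (pi : R) != 0 by rewrite gt_eqF // pi_gt0.
(* If 0 lies in the support it is the left endpoint, hence a root of [mp_quad], and both sides are
   0. *)
have [xE|xn0] := eqVneq x 0; last first.
  by rewrite /mp_quad; move: (pi : R) pi0 => p p0; field; rewrite p0 xn0.
suff -> : mp_quad R a x = 0 by rewrite xE sqrtr0 !(mulr0, mul0r).
move: xs; rewrite inE /mp_support /= in_itv /= => /andP[lx _].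
rewrite mp_quad_factor // (_ : (1 - Num.sqrt a) ^+ 2 = 0) ?xE ?subrr ?mul0r //.
by apply: le_anti; rewrite sqr_ge0 -{1}xE lx.
Qed.

End MarchenkoPasturMoments.

Theorem mainTheorem6 (R : realType) (a : R) (n : nat) (ha : 0 < a)
    (hn : (1 <= n)%N) :
  moment (marchenko_pastur a) n =
  (\sum_(P : {set {set 'I_(2 * n)}} | noncrossing_pairing P)
      a ^+ odd_blocks P)%:E.
Proof.
case: n hn => // n _; rewrite moment_marchenko_pastur //; congr EFin.
have a0 : a != 0 by rewrite gt_eqF.
have pi0 : (pi : R) != 0 by rewrite gt_eqF // pi_gt0.
(* Normalised by the total mass, so that m_0 = 1. *)
pose m k := (2 * pi * a)^-1 * semicircle_moment R a k.
have m0 : m 0%N = 1.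
  by rewrite /m semicircle_moment0 // mulVf // !mulf_neq0 // pnatr_eq0.
have mrec k : k.+3%:R * m k.+1 = (2 * k + 3)%:R * (1 + a) * m k
    - k%:R * ((1 + a) ^+ 2 - 4 * a) * m k.-1.
  by rewrite /m mulrCA semicircle_moment_rec // mulrBr !(mulrCA _ (2 * pi * a)^-1).
have mS := three_term_quadratic R a (1 + a) m a0 m0 mrec.
(* The first point has position 0, hence an odd label: the sum is a m_n, and this [a] cancels the
   one in the normalisation. *)
have := pairing_sum_quadratic R a m m0 mS (2 * n.+1) 0 (2 * n.+1) (leqnn _).
rewrite add0n mul2n odd_double doubleK /= expr1 /pairing_sum -mul2n => E.
rewrite (eq_bigl (itv_pairing (2 * n.+1) 0 (2 * n.+1))) => [|P]; last first.
  by rewrite itv_pairingT.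
rewrite E /m; move: (pi : R) pi0 => p p0.
by field; rewrite a0 p0.
Qed.
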